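(* Let $F$ be a free group and let $S_1$ and $S_2$ be finitely generated subgroups of $F$. Let $S_1 \vee S_2$ denote the subgroup of $F$ generated by $S_1 \cup S_2$. If $S_1 \cap S_2$ satisfies the Burnside condition in $S_1$ and also satisfies the Burnside condition in $S_2$, then $S_1 \cap S_2$ satisfies the Burnside condition in $S_1 \vee S_2$.
   Context: A subgroup $S$ of a group $G$ satisfies the Burnside condition (in $G$) if for every $g \in G$ there exists a positive integer $n$ (which may depend on $g$) such that $g^n \in S$. *)

(* Defs.v *)
From HB Require Import structures.
From mathcomp Require Import all_boot.
From mathcomp Require Import boolp classical_sets cardinality.

Set Implicit Arguments.
Unset Strict Implicit.
Unset Printing Implicit Defensive.

Local Open Scope classical_set_scope.
Local Open Scope group_scope.

(* Groups are [groupType]s, possibly infinite. Their subsets are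
   [Prop]-valued, so that no decidability of membership is assumed. *)

Definition is_subgroup (G : groupType) (S : set G) : Prop :=
  group_closed (mem S).

Definition generated (G : groupType) (X : set G) : set G :=
  smallest (@is_subgroup G) X.

Definition finitely_generated (G : groupType) (S : set G) : Prop :=
  exists2 X : set G, finite_set X & generated X = S.

(* Universal property of the inclusion of [B] in [F]: a map from [B] to a
   group is given as the restriction to [B] of a total function [f]. *)
Definition free_basis (F : groupType) (B : set F) : Prop :=
  forall (H : groupType) (f : F -> H),
    exists! phi : F -> H, monoid_morphism phi /\ {in B, phi =1 f}.

Definition is_free_group (F : groupType) : Prop :=
  exists B : set F, free_basis B.

Definition burnside_condition (G : groupType) (S K : set G) : Prop :=
  forall g, K g -> exists2 n : nat, 0 < n & S (g ^+ n).

(* Main.v *)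
(** View [F] as the vertex set of its Cayley tree. For a subgroup [S], the union
    of the axes of its nontrivial elements is an [S]-invariant set of vertices,
    contained in finitely many [S]-orbits when [S] is finitely generated. An
    element and its positive powers have the same axis, so by the Burnside
    conditions [S1], [S2] and their intersection have the same union of axes
    [V], which is therefore invariant under the join. If [x] lies in [V], then
    by pigeonhole two points [g ^+ i * x], [g ^+ j * x] with [i < j] lie in the
    same [S1]-orbit, whence [g ^+ (j - i)] is in [S1] since the action is free.
    If [V] is empty, both subgroups are trivial. *)

From HB Require Import structures.
Require Import Defs.
From mathcomp Require Import all_boot.
From mathcomp Require Import boolp classical_sets cardinality.

Set Implicit Arguments.
Unset Strict Implicit.
Unset Printing Implicit Defensive.

Local Open Scope classical_set_scope.
Local Open Scope group_scope.

(** * Words in letters and their inverses, and the normal form in a free group *)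

Local Notation letter X := (X * bool)%type.

Definition letter_inv {X : choiceType} (a : letter X) : letter X :=
  (a.1, ~~ a.2).

Definition word_inv {X : choiceType} (w : seq (letter X)) : seq (letter X) :=
  rev (map letter_inv w).

Definition no_cancel {X : choiceType} : rel (letter X) :=
  fun a b => b != letter_inv a.

Definition reduced {X : choiceType} (w : seq (letter X)) : bool :=
  sorted no_cancel w.

Definition push {X : choiceType} (a : letter X) (w : seq (letter X)) :
    seq (letter X) :=
  if w is b :: w' then if b == letter_inv a then w' else a :: w else [:: a].

Definition eval_letter {X : choiceType} {G : groupType} (v : X -> G)
    (a : letter X) : G :=
  if a.2 then v a.1 else (v a.1)^-1.

Definition eval {X : choiceType} {G : groupType} (v : X -> G)
    (w : seq (letter X)) : G :=
  foldr (fun a g => eval_letter v a * g) 1 w.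

Section Words.
Context {X : choiceType}.
Implicit Types (a b : letter X) (w u : seq (letter X)).

Lemma letter_invK : involutive (@letter_inv X).
Proof. by case=> x b; rewrite /letter_inv /= negbK. Qed.

Lemma no_cancel_inv a b :
  no_cancel (letter_inv b) (letter_inv a) = no_cancel a b.
Proof. by rewrite /no_cancel letter_invK eq_sym. Qed.

Lemma reduced_inv w : reduced (word_inv w) = reduced w.
Proof.
rewrite /reduced /word_inv rev_sorted sorted_map.
by case: w => //= a w; apply: eq_path => b c; rewrite /= no_cancel_inv.
Qed.

Lemma push_reduced a w : reduced w -> reduced (push a w).
Proof.
case: w => [//|b w] /=; case: ifPn => [_|ba] /=; first exact: path_sorted.
by move=> rw; rewrite /no_cancel ba.
Qed.

Lemma push_cons a w : reduced (a :: w) -> push a w = a :: w.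
Proof. by case: w => [//|b w] /= /andP[/negbTE-> _]. Qed.

Lemma pushK a w : reduced w -> push (letter_inv a) (push a w) = w.
Proof.
case: w => [_|b w rw] /=; first by rewrite letter_invK eqxx.
case: ifPn => [/eqP<-|_] /=; last by rewrite letter_invK eqxx.
exact: push_cons.
Qed.

Context {G : groupType} (v : X -> G).

Lemma eval_letter_inv a : eval_letter v (letter_inv a) = (eval_letter v a)^-1.
Proof. by case: a => x []; rewrite /eval_letter //= invgK. Qed.

Lemma eval_cat w u : eval v (w ++ u) = eval v w * eval v u.
Proof. by elim: w => [|a w IH] /=; rewrite ?mul1g // IH mulgA. Qed.

Lemma eval_inv w : eval v (word_inv w) = (eval v w)^-1.
Proof.
elim: w => [|a w IH]; first by rewrite /= invg1.
rewrite /word_inv /= rev_cons -cats1 eval_cat IH /= mulg1 eval_letter_inv.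
by rewrite invgM.
Qed.

Lemma eval_push a w : eval v (push a w) = eval_letter v a * eval v w.
Proof.
case: w => [//|b w] /=; case: ifP => [/eqP->|//].
by rewrite eval_letter_inv mulVKg.
Qed.

Lemma eval_flatten w n : eval v (flatten (nseq n w)) = eval v w ^+ n.
Proof. by elim: n => [//|n IH]; rewrite /= eval_cat IH expgS. Qed.

(* The permutation part of a lifting separates reduced words; the base part
   recovers the identity of the free group by uniqueness in its universal
   property, so that every element is the value of a reduced word. *)
Record lifting := Lifting {
  lift_base : G;
  lift_fwd :
    {w : seq (letter X) | reduced w} -> {w : seq (letter X) | reduced w};
  lift_bwd :
    {w : seq (letter X) | reduced w} -> {w : seq (letter X) | reduced w};
  lift_fwdK : cancel lift_fwd lift_bwd;
  lift_bwdK : cancel lift_bwd lift_fwd;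
  lift_fwdE : forall r, eval v (val (lift_fwd r)) = lift_base * eval v (val r)
}.

Lemma lifting_eq (p q : lifting) :
  lift_base p = lift_base q -> lift_fwd p =1 lift_fwd q -> p = q.
Proof.
case: p q => g f f' fK f'K fE [h k k' kK k'K kE] /= gh /funext fk.
move: gh fk fE fK f'K => -> -> fE fK f'K.
have f'k' : f' = k' by apply: funext => w; rewrite -[w in LHS]k'K fK.
move: f'k' fK f'K => -> fK f'K.
by congr Lifting; apply: Prop_irrelevance.
Qed.

Lemma lift_fwd_mul (p q : lifting) r :
  eval v (val (lift_fwd p (lift_fwd q r))) =
  lift_base p * lift_base q * eval v (val r).
Proof. by rewrite !lift_fwdE mulgA. Qed.

Lemma lift_bwdE (p : lifting) r :
  eval v (val (lift_bwd p r)) = (lift_base p)^-1 * eval v (val r).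
Proof. by rewrite -[r in RHS](lift_bwdK p) lift_fwdE mulKg. Qed.

Definition lifting_one : lifting :=
  @Lifting 1 id id (fun=> erefl) (fun=> erefl) (fun=> esym (mul1g _)).

Definition lifting_mul (p q : lifting) : lifting :=
  Lifting (can_comp (lift_fwdK p) (lift_fwdK q))
    (can_comp (lift_bwdK q) (lift_bwdK p)) (lift_fwd_mul p q).

Definition lifting_inv (p : lifting) : lifting :=
  Lifting (lift_bwdK p) (lift_fwdK p) (lift_bwdE p).

HB.instance Definition _ := gen_eqMixin lifting.
HB.instance Definition _ := gen_choiceMixin lifting.

Lemma lifting_mulA : associative lifting_mul.
Proof. by move=> p q r; apply: lifting_eq => //=; rewrite mulgA. Qed.

Lemma lifting_mul1g : left_id lifting_one lifting_mul.
Proof. by move=> p; apply: lifting_eq => //=; rewrite mul1g. Qed.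

Lemma lifting_mulg1 : right_id lifting_one lifting_mul.
Proof. by move=> p; apply: lifting_eq => //=; rewrite mulg1. Qed.

Lemma lifting_mulVg : left_inverse lifting_one lifting_inv lifting_mul.
Proof.
by move=> p; apply: lifting_eq => [|w] /=; rewrite ?mulVg ?lift_fwdK.
Qed.

Lemma lifting_mulgV : right_inverse lifting_one lifting_inv lifting_mul.
Proof.
by move=> p; apply: lifting_eq => [|w] /=; rewrite ?mulgV ?lift_bwdK.
Qed.

HB.instance Definition _ := isGroup.Build lifting lifting_mulA lifting_mul1g
  lifting_mulg1 lifting_mulVg lifting_mulgV.

Definition push_red (a : letter X) (w : {w : seq (letter X) | reduced w}) :
    {w : seq (letter X) | reduced w} :=
  exist _ (push a (val w)) (push_reduced a (valP w)).

Lemma push_redK a : cancel (push_red a) (push_red (letter_inv a)).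
Proof. by move=> w; apply: val_inj => /=; rewrite pushK ?(valP w). Qed.

Lemma push_redVK a : cancel (push_red (letter_inv a)) (push_red a).
Proof. by rewrite -{2}[a]letter_invK; exact: push_redK. Qed.

Definition lifting_letter (a : letter X) : lifting :=
  @Lifting (eval_letter v a) (push_red a) (push_red (letter_inv a))
    (push_redK a) (push_redVK a) (fun r => eval_push a (val r)).

End Words.

(** The universal property yields a morphism sending each basis element to the lifting that pushes
    its letter; [norm g] is what the lifting of [g] makes of the empty word. *)
Lemma free_normal_form {F : groupType} {B : set F} : free_basis B ->
  let v : {x : F | x \in B} -> F := val in
  exists norm : F -> seq (letter {x : F | x \in B}),
    [/\ norm 1 = [::],
        forall a g, norm (eval_letter v a * g) = push a (norm g)
      & forall g, eval v (norm g) = g].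
Proof.
move=> hB v.
pose f x : lifting v :=
  (* [1] is a dummy value: the universal property reads [f] only on [B]. *)
  if insub x is Some y then lifting_letter v (y, true) else 1.
have [phi [[[phi1 phiM] phiB] _]] := hB (lifting v) f.
have base_phi : @lift_base _ _ v \o phi = id.
  have [psi [_ uniq_psi]] := hB F id.
  rewrite -(uniq_psi (@lift_base _ _ v \o phi)); last first.
    split; last by move=> x xB /=; rewrite phiB // /f insubT.
    by split=> [|x y] /=; rewrite ?phi1 ?phiM.
  by apply: uniq_psi; split.
have phi_gen x : phi (v x) = lifting_letter v (x, true).
  by rewrite phiB ?(valP x) // /f valK.
have phiV x : phi x^-1 = (phi x)^-1.
  by apply/esym/mulg1_eq; rewrite -phiM mulgV phi1.
have phi_letter a w : val (lift_fwd (phi (eval_letter v a)) w) = push a (val w).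
  by case: a => x [] /=; rewrite /eval_letter /= ?phiV phi_gen.
pose w0 : {w : seq (letter {x : F | x \in B}) | reduced w} := exist _ [::] isT.
exists (fun g => val (lift_fwd (phi g) w0)); split=> [|a g|g].
- by rewrite phi1.
- by rewrite phiM /= phi_letter.
- by rewrite lift_fwdE mulg1 -[RHS]/(id g) -base_phi.
Qed.

Lemma injective_avoids {T : eqType} (f : nat -> T) (s : seq T) :
  injective f -> exists N, forall n, N <= n -> f n \notin s.
Proof.
move=> f_inj; elim: s => [|x s [N IH]]; first by exists 0.
have [[m fm]|no_m] := pselect (exists m, f m = x); last first.
  exists N => n Nn; rewrite inE negb_or IH // andbT.
  by apply/eqP => fn; apply: no_m; exists n.
exists (maxn N m.+1) => n; rewrite geq_max => /andP[Nn mn].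
rewrite inE negb_or IH // andbT -fm; apply/eqP => /f_inj nm.
by rewrite nm ltnn in mn.
Qed.

Lemma subgroup_expg {F : groupType} (S : set F) g n :
  is_subgroup S -> S g -> S (g ^+ n).
Proof.
move=> Sgrp Sg; elim: n => [|n IH]; first by apply/set_mem; case: Sgrp.
by rewrite expgS; apply/set_mem/(group_closedM Sgrp); rewrite inE.
Qed.

(** * Directions, axes and hulls in the Cayley tree *)

Section Ends.
Context {F : groupType} {X : choiceType} (v : X -> F).
Context (norm : F -> seq (letter X)) (norm1 : norm 1 = [::]).
Context (norm_mul : forall a g, norm (eval_letter v a * g) = push a (norm g)).
Context (normK : forall g, eval v (norm g) = g).

Lemma norm_reduced g : reduced (norm g).
Proof.
rewrite -[g]normK; elim: (norm g) => [|a w IH] /=; first by rewrite norm1.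
by rewrite norm_mul push_reduced.
Qed.

Lemma norm_eval w : reduced w -> norm (eval v w) = w.
Proof.
elim: w => [|a w IH] rw //=.
by rewrite norm_mul IH ?push_cons //; apply: path_sorted rw.
Qed.

(* The component containing [g] of the Cayley tree with the vertex [1] removed,
   and [None] for [g = 1]. *)
Definition dir (g : F) : option (letter X) := ohead (norm g).

(** Right multiplication by a letter appends or deletes a last letter, so the first letter survives
    while the word stays nonempty. *)
Lemma dir_mul_letter y a :
  y <> 1 -> y * eval_letter v a <> 1 -> dir (y * eval_letter v a) = dir y.
Proof.
rewrite /dir; move: (norm_reduced y) (normK y).
case/lastP: (norm y) => [|w b] rwb; first by move=> <- /(_ erefl).
rewrite -cats1 eval_cat /= mulg1 => <- _.
have [->|ba] := eqVneq b (letter_inv a).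
  rewrite eval_letter_inv mulgVK => w1.
  rewrite norm_eval; last first.
    by move: rwb; rewrite /reduced -cats1 => /cat_sorted2[].
  by case: w w1 {rwb}.
move=> _; have -> : eval v w * eval_letter v b * eval_letter v a =
    eval v (rcons (rcons w b) a).
  by rewrite -!cats1 !eval_cat /= !mulg1.
rewrite norm_eval; first by case: w {rwb}.
case: w rwb => [_|c w] /=.
  by rewrite andbT /no_cancel eq_sym (inv_eq letter_invK).
rewrite /reduced /= !rcons_path => ->; rewrite last_rcons /=.
by rewrite /no_cancel eq_sym (inv_eq letter_invK).
Qed.

(* [P] lists the prefixes of [s]: the path from [y] to [y * s] meets [1] only
   if [y * p = 1] for one of them. *)
Lemma dir_mul s : exists P : seq F,
  forall y, (forall p, p \in P -> y * p <> 1) -> dir (y * s) = dir y.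
Proof.
rewrite -[s]normK; elim: (norm s) => [|a w [P IH]].
  by exists [::] => y _; rewrite mulg1.
(* [eval_letter v a] is listed apart because [P] need not contain [1]: it is empty for the empty
   word. *)
exists [:: 1, eval_letter v a & map (mul (eval_letter v a)) P] => y hy /=.
rewrite mulgA IH ?dir_mul_letter //.
- by rewrite -[y]mulg1; apply: hy; rewrite inE eqxx.
- by apply: hy; rewrite !inE eqxx orbT.
- move=> p pP; rewrite -mulgA; apply: hy.
  by rewrite !inE (map_f (mul (eval_letter v a))) ?orbT.
Qed.

(** No cancellation occurs where copies of the word meet, so their concatenation is the normal form
    of the power. *)
Lemma dir_expg a u n :
  reduced (a :: u) -> no_cancel (last a u) a ->
  dir (eval v (a :: u) ^+ n.+1) = Some a.
Proof.
move=> rw ua; rewrite -eval_flatten /dir norm_eval //.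
suff: path no_cancel (last a u) (flatten (nseq n.+1 (a :: u))).
  by rewrite /= => /andP[_].
elim: n.+1 => //= k IH; rewrite ua cat_path IH andbT; exact: rw.
Qed.

(* The vertices [x] of the Cayley tree whose removal separates the two ends of
   the sequence [g ^+ n], [n] in Z. *)
Definition axis (g : F) : set F :=
  [set x | exists N, forall n, N <= n ->
     dir (x^-1 * g ^+ n) <> dir (x^-1 * g ^- n)].

(** If [g] had finite order, then at large multiples of the order both [g ^+ n] and [g ^- n] would
    be [1] and give the same direction. *)
Lemma axis_expg_inj g x : axis g x -> injective (fun n => g ^+ n).
Proof.
move=> [N axN].
have torsion_free k : g ^+ k = 1 -> k = 0.
  case: k => // k gk; have [] := axN (k.+1 * N)%N; first by rewrite leq_pmull.
  by rewrite expgnA gk expg1n invg1.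
move=> i j; wlog le_ij : i j / i <= j => [th|] gij.
  by case/orP: (leq_total i j) => /th; [apply|move=> h; apply/esym/h].
apply/eqP; rewrite eqn_leq le_ij -subn_eq0; apply/eqP/torsion_free.
by rewrite expgnFr // gij mulgV.
Qed.

Lemma axis_expg g x m : 0 < m -> axis g x -> axis (g ^+ m) x.
Proof.
move=> m0 [N axN]; exists N => n Nn; rewrite -expgnA.
by apply: axN; apply: leq_trans Nn _; rewrite leq_pmull.
Qed.

(** Seen from [s * x], the powers of the conjugate are [x^-1 * g ^+ n * s^-1]. The path from
    [g ^+ n] to [g ^+ n * s^-1] is a translate of a fixed finite one, so by injectivity it misses
    [x] for large [n]; likewise for [g ^- n]. *)
Lemma axis_conj g x s : axis g x -> axis (s * g * s^-1) (s * x).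
Proof.
move=> axg; have g_inj := axis_expg_inj axg; have [N axN] := axg.
have [P dirP] := dir_mul s^-1.
have gV_inj : injective (fun n => g ^- n).
  by move=> i j /(congr1 (@inv F)); rewrite !invgK => /g_inj.
have [N1 hN1] := injective_avoids [seq x * p^-1 | p <- P] g_inj.
have [N2 hN2] := injective_avoids [seq x * p^-1 | p <- P] gV_inj.
have avoid h : h \notin [seq x * p^-1 | p <- P] ->
    dir (x^-1 * h * s^-1) = dir (x^-1 * h).
  move=> hP; apply: dirP => p pP xhp; case/mapP: hP; exists p => //.
  by rewrite -(mulg1_eq xhp) invgK mulVKg.
exists (maxn N (maxn N1 N2)) => n; rewrite !geq_max => /and3P[Nn N1n N2n].
have expE : (s * g * s^-1) ^+ n = s * g ^+ n * s^-1.
  elim: n {Nn N1n N2n} => [|n IH]; first by rewrite mulg1 mulgV.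
  by rewrite !expgS IH !mulgA mulgVK.
rewrite expE !invgM invgK !mulgA !mulgVK.
by rewrite avoid ?avoid; [apply: axN|apply: hN2|apply: hN1].
Qed.

(* Up to conjugation [g] is given by a cyclically reduced word, whose powers are
   reduced and start with its first letter. *)
Lemma axis_nonempty g : g <> 1 -> exists x, axis g x.
Proof.
rewrite -[g]normK; move: (norm g) (norm_reduced g) => w.
have [m] := ubnP (size w); elim: m w => // m IH [//|a u] /= um rw _.
have [ua|] := boolP (no_cancel (last a u) a).
  (* Positive powers start with [a], negative ones with the inverse of the last letter, which
     differs from [a] by [ua]. The bound 1 leaves out the zeroth power, which has no direction. *)
  exists 1; exists 1%N => -[//|n] _; rewrite invg1 !mul1g dir_expg // -expVgn.
  have -> : (eval_letter v a * eval v u)^-1 = eval v (word_inv (a :: u)).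
    by rewrite eval_inv.
  have: reduced (word_inv (a :: u)) by rewrite reduced_inv.
  have: last (letter_inv a) (word_inv (a :: u)) = letter_inv a.
    by rewrite /word_inv /= rev_cons last_rcons.
  rewrite /word_inv lastI map_rcons rev_rcons /= => lastV redV.
  rewrite dir_expg //; last by rewrite lastV no_cancel_inv.
  by case=> aE; move: ua; rewrite /no_cancel -aE eqxx.
(* Here the first letter is the inverse of the last letter [b], so the word is [b^-1 u b], a
   conjugate of the shorter [u]. *)
rewrite /no_cancel negbK => /eqP aE.
case/lastP: u um rw aE => [|u b] um rw.
  by move=> /(congr1 snd) /=; case: (a.2).
rewrite last_rcons => aE; rewrite {a}aE in rw *.
rewrite -cats1 eval_cat /= mulg1 eval_letter_inv.
move: rw; rewrite /reduced /= rcons_path => /andP[/path_sorted ru ub].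
have u1 : eval v u <> 1.
  move=> /(congr1 norm); rewrite norm1 norm_eval; last exact: ru.
  by move=> uE; move: ub; rewrite uE /= /no_cancel letter_invK eqxx.
have [|x axu] := IH u _ ru u1.
  by move: um; rewrite size_rcons ltnS => /ltnW.
exists ((eval_letter v b)^-1 * x).
by rewrite -{2}[eval_letter v b]invgK mulgA; apply: axis_conj.
Qed.

Definition hull (S : set F) : set F := [set x | exists2 g, S g & axis g x].

Lemma hull_mul S s x : is_subgroup S -> S s -> hull S x -> hull S (s * x).
Proof.
move=> Sgrp Ss [g Sg axg]; exists (s * g * s^-1); last exact: axis_conj.
have [S1 SB] := Sgrp; have SM := group_closedM Sgrp.
by apply/set_mem/SB; rewrite ?SM // ?inE.
Qed.

(** A vertex on the axis of [g] lies on the axis of each positive power of [g], and one of these is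
    in [S]. *)
Lemma hull_burnside S T : S `<=` T -> burnside_condition S T -> hull S = hull T.
Proof.
move=> ST ST_burnside; apply/seteqP; split=> x [g Hg axg].
  by exists g => //; apply: ST.
have [n n0 Sgn] := ST_burnside g Hg.
by exists (g ^+ n) => //; apply: axis_expg.
Qed.

(* Off the translates of the prefixes of the generators, [dir (x^-1 * h)] does
   not depend on [h] in [S], so [x] separates no two elements of [S]. *)
Lemma hull_cover S : is_subgroup S -> finitely_generated S ->
  exists A : seq F, forall x, hull S x -> exists2 a, a \in A & S (x * a^-1).
Proof.
move=> Sgrp [Y /finite_seqP[s Ys] genS].
have [S1 SB] := Sgrp.
have SM := group_closedM Sgrp; have SV := group_closedV Sgrp.
have [P dirP] := choice dir_mul.
exists (flatten (map P s)) => x [g Sg [N axg]].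
apply: contrapT => no_a; apply: (axg N) => //.
have indep k : S k -> forall h, S h -> dir (x^-1 * h * k) = dir (x^-1 * h).
  (* [K] is a subgroup, so it is enough to multiply by one generator. *)
  pose K :=
    [set k | S k /\ forall h, S h -> dir (x^-1 * h * k) = dir (x^-1 * h)].
  suff SK : S `<=` K by move=> /SK[].
  rewrite -genS; apply: smallest_sub.
    split; first by rewrite inE; split=> [|h _]; rewrite ?mulg1 // -inE.
    move=> a b; rewrite !inE => -[Sa aE] [Sb bE].
    have SbV : S b^-1 by apply/set_mem/SV; rewrite inE.
    split=> [|h Sh]; first by apply/set_mem/SB; rewrite inE.
    have Sha : S (h * a) by apply/set_mem/SM; rewrite inE.
    have Shab : S (h * a * b^-1) by apply/set_mem/SM; rewrite inE.
    have -> : x^-1 * h * (a * b^-1) = x^-1 * (h * a * b^-1) by rewrite !mulgA.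
    by rewrite -bE // -(mulgA x^-1) mulgVK mulgA aE.
  move=> y Yy; have Sy : S y by rewrite -genS; apply: sub_gen_smallest.
  (* If the path from [x^-1 * h] met [1], then [h] would be [x * p^-1] for a listed [p], against
     [no_a]. *)
  split=> // h Sh; apply: dirP => p pP xhp; apply: no_a; exists p.
    by apply/flattenP; exists (P y) => //; apply: map_f; move: Yy; rewrite Ys.
  suff -> : x * p^-1 = h by [].
  by rewrite -(mulg1_eq xhp) invgK mulVKg.
have SX h : S h -> dir (x^-1 * h) = dir x^-1.
  by move=> Sh; have := indep h Sh 1 (set_mem S1); rewrite mulg1.
have Sn n : S (g ^+ n) by exact: subgroup_expg.
by rewrite !SX //; apply/set_mem/SV; rewrite inE.
Qed.

Lemma hull_trivial S g : S g -> ~ (exists x, hull S x) -> g = 1.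
Proof.
move=> Sg noS; apply: contrapT => /axis_nonempty[x axg].
by apply: noS; exists x, g.
Qed.

End Ends.

(** * Pigeonhole on orbits, and the join of the two subgroups *)

Lemma generated_subgroup {F : groupType} (Y : set F) :
  is_subgroup (generated Y).
Proof.
split; first by rewrite inE => T [[T1 _] _]; apply/set_mem.
move=> a b; rewrite !inE => Ya Yb T YT; have [[_ TB] _] := YT.
by apply/set_mem/TB; rewrite inE; [apply: Ya|apply: Yb].
Qed.

(** Two of the points [g ^+ n * x] share a representative in [A]; dividing the corresponding
    elements of [S] cancels [x] and leaves a positive power of [g]. *)
Lemma orbit_pigeonhole {F : groupType} (S : set F) (A : seq F) (g x : F) :
  is_subgroup S -> (forall n, exists2 a, a \in A & S (g ^+ n * x * a^-1)) ->
  exists2 n, 0 < n & S (g ^+ n).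
Proof.
move=> Sgrp cover.
have /choice[a aP] n : exists b, b \in A /\ S (g ^+ n * x * b^-1).
  by have [b] := cover n; exists b.
have [a_inj|] := pselect (injective a).
  have [N /(_ N (leqnn N))] := injective_avoids A a_inj.
  by rewrite (aP N).1.
move=> a_ninj; have [i [j [ij aij]]] : exists i j, i < j /\ a i = a j.
  apply: contrapT => no_ij; apply: a_ninj => i j aij.
  by case: (ltngtP i j) => // ij; case: no_ij; [exists i, j|exists j, i].
exists (j - i); first by rewrite subn_gt0.
have [_ Si] := aP i; have [_ Sj] := aP j; rewrite aij in Si.
have := (Sgrp.2 _ _ (mem_set Sj) (mem_set Si)).
rewrite inE !invgM invgK !mulgA mulgVK mulgK -expgnFr //; exact: ltnW.
Qed.

Theorem theorem3p2 (F : groupType) (S1 S2 : set F)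
    (hF : is_free_group F)
    (hS1 : is_subgroup S1) (hS2 : is_subgroup S2)
    (fgS1 : finitely_generated S1) (fgS2 : finitely_generated S2)
    (hB1 : burnside_condition (S1 `&` S2) S1)
    (hB2 : burnside_condition (S1 `&` S2) S2) :
  burnside_condition (S1 `&` S2) (generated (S1 `|` S2)).
Proof.
have [B /free_normal_form[norm [norm1 norm_mul normK]]] := hF.
set V := hull norm S1.
(* Both hulls equal that of the intersection. *)
have VS2 : V = hull norm S2.
  rewrite /V -(hull_burnside norm _ hB1) //.
  by rewrite (hull_burnside norm _ hB2).
move=> g Jg; have [[x Vx]|noV] := pselect (exists x, V x); last first.
  suff -> : g = 1.
    exists 1%N => //; rewrite expg1; split; apply/set_mem.
      exact: hS1.1.
    exact: hS2.1.
  suff: generated (S1 `|` S2) `<=` [set 1] by apply.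
  apply: smallest_sub.
    by split=> [|a b]; rewrite ?inE // => -> ->; rewrite mulgV.
  move=> h [] Sh.
    exact: (hull_trivial norm1 norm_mul normK Sh).
  by apply: (hull_trivial norm1 norm_mul normK Sh); rewrite -VS2.
(* The equivalence, rather than one implication, makes this stabilizer closed under inverses. *)
have stabV : generated (S1 `|` S2) `<=` [set h | forall y, V (h * y) <-> V y].
  have stab S h : is_subgroup S -> V = hull norm S -> S h ->
      forall y, V (h * y) <-> V y.
    move=> Sgrp VS Sh y; rewrite VS; split; last first.
      exact: (hull_mul norm1 norm_mul normK).
    rewrite -{2}[y](mulKg h); apply: (hull_mul norm1 norm_mul normK) => //.
    by apply/set_mem/(group_closedV Sgrp); rewrite inE.
  apply: smallest_sub; last first.
    by move=> h [] Sh; [apply: (stab S1)|apply: (stab S2)].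
  split; first by rewrite inE => y; rewrite mul1g.
  move=> a b; rewrite !inE /= => aV bV y.
  by rewrite -mulgA aV -bV mulVKg.
have [A coverA] := hull_cover norm1 norm_mul normK hS1 fgS1.
have [n n0 S1gn] : exists2 n, 0 < n & S1 (g ^+ n).
  apply: (@orbit_pigeonhole _ S1 A g x hS1) => n; apply: coverA.
  have Jgn := subgroup_expg n (generated_subgroup (S1 `|` S2)) Jg.
  by have /(_ x)[_] := stabV _ Jgn; apply.
have [m m0 Hgnm] := hB1 _ S1gn.
by exists (n * m)%N; rewrite ?muln_gt0 ?n0 // expgnA.
Qed.
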